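(* There exists an absolute constant $C>0$ such that for every $k\in\mathbb{N}$, $k\ge2$, for every probability measure $\nu$ on $\mathbb{R}$ with a density $\varrho$ of bounded variation, and for every $f\in C^\infty(\mathbb{R})$ satisfying $f^{(k)}(t)\ge1$ for all $t\in\mathbb{R}$, one has $$\sigma\bigl(\nu\circ f^{-1},\varepsilon\bigr)\le Ck\,\|\varrho\|_{\dot{BV}(\mathbb{R})}\cdot\varepsilon^{1/k}\qquad\forall\varepsilon>0.$$
   Context: Functions are real-valued. $\nu\circ f^{-1}$ is the image measure: $\nu\circ f^{-1}(A)=\nu(f^{-1}(A))$ for Borel $A\subset\mathbb{R}$. $C_b^\infty(\mathbb{R})$ is the space of bounded smooth functions with bounded derivatives of every order, $\|\cdot\|_\infty$ is the sup-norm. For a bounded Borel measure $\nu$ on $\mathbb{R}$ and $\varepsilon>0$, $$\sigma(\nu,\varepsilon):=\sup\Bigl\{\int_{\mathbb{R}}\varphi'(t)\,\nu(dt):\ \varphi\in C_b^\infty(\mathbb{R}),\ \|\varphi\|_\infty\le\varepsilon,\ \|\varphi'\|_\infty\le1\Bigr\}.$$ For $\varrho\in L^1(\mathbb{R})$ let $\omega(\varrho,\varepsilon):=\sup_{|h|\le\varepsilon}\int_{\mathbb{R}}|\varrho(x+h)-\varrho(x)|\,dx$ and $\|\varrho\|_{\dot{BV}(\mathbb{R})}:=\sup_{\varepsilon>0}\varepsilon^{-1}\omega(\varrho,\varepsilon)$; $\varrho$ is of bounded variation if this quantity is finite. ''Absolute constant'' means independent of $k,\nu,f,\varepsilon$.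 *)

(* Defs.v *)
From HB Require Import structures.
From mathcomp Require Import all_boot all_order all_algebra.
From mathcomp Require Import all_classical all_reals all_analysis.
Import Order.TTheory GRing.Theory Num.Theory.
Import numFieldNormedType.Exports.

Set Implicit Arguments.
Unset Strict Implicit.
Unset Printing Implicit Defensive.

Local Open Scope classical_set_scope.
Local Open Scope ring_scope.

Definition smooth (R : realType) (f : R -> R) : Prop :=
  forall (n : nat) (x : R), derivable (derive1n n f) x 1.

(* The bound on the n-th derivative may depend on n; n = 0 bounds phi itself. *)
Definition smooth_bounded (R : realType) (phi : R -> R) : Prop :=
  smooth phi /\
  forall n : nat, exists M : R, forall x : R, `|derive1n n phi x| <= M.

Definition sup_norm (R : realType) (phi : R -> R) : \bar R :=
  ereal_sup [set (`|phi x|)%:E | x in [set: R]].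

(* nu is a bare set function so that sigma applies directly to
   [pushforward nu f], whose bundled measure structure needs a proof that f is
   measurable; the integral is the Lebesgue integral when nu is a nonnegative
   measure, and is not meant for signed measures. *)
Definition sigma (R : realType) (nu : set (measurableTypeR R) -> \bar R)
    (eps : R) : \bar R :=
  ereal_sup [set (\int[nu]_(t in [set: R]) (derive1 phi t)%:E)%E | phi in
    [set phi : R -> R | [/\ smooth_bounded phi,
                            (sup_norm phi <= eps%:E)%E &
                            (sup_norm (derive1 phi) <= 1%:E)%E]]].

Definition omega (R : realType) (rho : R -> R) (eps : R) : \bar R :=
  ereal_sup
    [set (\int[lebesgue_measure]_(x in [set: R]) (`|rho (x + h) - rho x|)%:E)%E
       | h in [set h : R | `|h| <= eps]].

Definition BVnorm (R : realType) (rho : R -> R) : \bar R :=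
  ereal_sup [set ((eps^-1)%:E * omega rho eps)%E | eps in [set eps : R | 0 < eps]].

(* Nonnegativity of rho is not imposed: for a measure nu it follows, almost
   everywhere, from the second clause. *)
Definition has_density (R : realType)
    (nu : set (measurableTypeR R) -> \bar R) (rho : R -> R) : Prop :=
  (@lebesgue_measure R).-integrable [set: R] (EFin \o rho) /\
  forall A : set (measurableTypeR R), measurable A ->
    nu A = (\int[lebesgue_measure]_(x in A) (rho x)%:E)%E.

(* Main.v *)
(* Let psi be an antiderivative of phi' o f.  Moving difference quotients of psi
   onto rho gives int psi' rho <= sup |psi| * ||rho||_BV, so it suffices to bound
   psi b - psi a by a multiple of k r, where r = eps^(1/k) (van der Corput).  Let
   m = k - 1, delta = r^m.  Since f^(k) >= 1, the mean value theorem for divided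
   differences forbids m + 1 points of {|f'| <= delta} that are pairwise 3 r
   apart, and f'' has at most m - 1 zeros by Rolle.  Hence O(k) points cut [a, b]
   into intervals that either have length at most 3 r, or on which
   |f'| >= delta and f' is monotone; on the latter psi varies by at most
   4 eps / delta = 4 r, which makes the constant linear in k. *)
Require Import Defs.
From HB Require Import structures.
From mathcomp Require Import all_boot all_order all_algebra.
From mathcomp Require Import all_classical all_reals all_analysis.
From mathcomp Require Import measurable_realfun.
From mathcomp Require Import lra ring zify.
Import Order.TTheory GRing.Theory Num.Theory.
Import numFieldNormedType.Exports.
Set Implicit Arguments.
Unset Strict Implicit.
Unset Printing Implicit Defensive.
Local Open Scope classical_set_scope.
Local Open Scope ring_scope.

(** * Rolle's theorem and divided differences *)

Section DividedDifferences.
Variable R : realType.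
Implicit Types (h : nat -> R -> R) (s : seq R).

Lemma is_derive_continuous (F dF : R -> R) (x : R) :
  (forall y : R, is_derive y 1 F (dF y)) -> {for x, continuous F}.
Proof.
move=> dFE; apply: differentiable_continuous; apply/derivable1_diffP.
exact: (@ex_derive _ _ _ _ _ _ _ (dFE x)).
Qed.

Lemma is_derive_within (F dF : R -> R) (A : set R) :
  (forall y : R, is_derive y 1 F (dF y)) -> {within A, continuous F}.
Proof.
by move=> dFE; apply: continuous_subspaceT => x; apply: is_derive_continuous dFE.
Qed.

Lemma MVT_itv (F dF : R -> R) (a b : R) : a < b ->
  (forall y : R, is_derive y 1 F (dF y)) ->
  exists c, [/\ a < c, c < b & F b - F a = dF c * (b - a)].
Proof.
move=> ab dFE; have [c] := @MVT R F dF a b ab (fun x _ => dFE x) (is_derive_within dFE).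
by rewrite in_itv/= => /andP[ac cb] ?; exists c.
Qed.

(** Each gap between consecutive zeros of [F] contains a zero of [dF]. Stating [path <%R x t] keeps
    the new zeros to the right of [x], so the zero from the preceding gap can be prepended in the
    induction. *)
Lemma Rolle_path (F dF : R -> R) (x : R) s :
  (forall y : R, is_derive y 1 F (dF y)) -> path <%R x s -> F x = 0 ->
  all (fun y => F y == 0) s ->
  exists t, [/\ size t = size s, path <%R x t & all (fun y => dF y == 0) t].
Proof.
move=> dFE; elim: s x => [|y s IH] x /=; first by exists [::].
move=> /andP[xy ys] Fx /andP[/eqP Fy Fs].
have [t [tsz tp tz]] := IH y ys Fy Fs.
have [c [xc cy]] := MVT_itv xy dFE.
rewrite Fx Fy subrr => /esym/eqP; rewrite mulf_eq0 => dFc.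
exists (c :: t); split => /=; first by rewrite tsz.
  rewrite xc /=; case: t tp {tsz tz} => //= z t /andP[yz ->].
  by rewrite (lt_trans cy yz).
by rewrite tz andbT; case/orP: dFc => // /eqP yx;
  move: xy; rewrite -subr_gt0 yx ltxx.
Qed.

(** Successive derivatives form a family [h], so that the induction can pass to the shifted family,
    which has one known zero less. *)
Lemma Rolle_iter h n s :
  (forall i (y : R), is_derive y 1 (h i) (h i.+1 y)) -> sorted <%R s ->
  size s = n.+1 -> all (fun y => h 0%N y == 0) s -> exists x, h n x = 0.
Proof.
elim: n h s => [|n IH] h [//|x s] hD /=.
  by case: s => // _ _; rewrite andbT => /eqP ?; exists x.
move=> xs [ssz] /andP[/eqP hx hs].
have [t [tsz tp tz]] := Rolle_path (hD 0%N) xs hx hs.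
apply: (IH (fun i => h i.+1) t) => //; last by rewrite tsz.
exact: path_sorted tp.
Qed.

(* The mean value theorem for divided differences: [h m - P^`(m)] vanishes
   somewhere, where [P] is the Lagrange interpolant of [h 0] on [s]. *)
Lemma divided_difference h m s :
  (forall i (y : R), is_derive y 1 (h i) (h i.+1 y)) -> sorted <%R s ->
  size s = m.+1 ->
  exists xi, h m xi = m`!%:R * \sum_(j < m.+1) (h 0%N s`_j *
    \prod_(i < m.+1 | i != j) (s`_j - s`_i)^-1).
Proof.
move=> hD ss sz.
(* [L j] is the Lagrange basis polynomial without its normalising factor, which goes into [c j].
   Thus [L j] is monic of degree [m], and the coefficient of ['X^m] in [P] is the divided
   difference. *)
pose c (j : 'I_m.+1) := h 0%N s`_j * \prod_(i < m.+1 | i != j) (s`_j - s`_i)^-1.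
pose L (j : 'I_m.+1) : {poly R} := \prod_(i < m.+1 | i != j) ('X - (s`_i)%:P).
have szL j : size (L j) = m.+1.
  rewrite /L -big_filter; case: big_enumP => e _ _ [_ sze].
  by rewrite size_prod_XsubC sze (cardC1 j) card_ord.
pose P := \sum_j c j *: L j.
have szP : (size P <= m.+1)%N.
  apply: (leq_trans (size_sum _ _ _)); apply/bigmax_leqP => j _.
  by rewrite (leq_trans (size_scale_leq _ _))// szL.
have Pm : P`_m = \sum_j c j.
  rewrite /P coef_sum; apply: eq_bigr => j _; rewrite coefZ.
  suff -> : (L j)`_m = 1 by rewrite mulr1.
  have := monic_prod_XsubC (index_enum 'I_m.+1) (fun i => i != j) (fun i => s`_i).
  by move=> /monicP; rewrite lead_coefE -/(L j) szL.
have sinj (i j : 'I_m.+1) : i != j -> s`_j - s`_i != 0.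
  move=> ij; rewrite subr_eq0; apply: contra ij => /eqP e; apply/eqP/val_inj/eqP.
  rewrite -(@nth_uniq _ 0 s i j) ?sz ?e//.
  exact: (sorted_uniq lt_trans ltxx).
have PE (j : 'I_m.+1) : P.[s`_j] = h 0%N s`_j.
  rewrite /P horner_sum (bigD1 j)//= big1 ?addr0 => [|i ij].
    rewrite hornerZ /L horner_prod /c -mulrA -big_split/= big1 ?mulr1//.
    by move=> i ij; rewrite hornerXsubC mulVf// sinj.
  rewrite hornerZ /L horner_prod (bigD1 j) 1?eq_sym//=.
  by rewrite hornerXsubC subrr mul0r mulr0.
have [xi] : exists xi, h m xi - (P^`(m)).[xi] = 0.
  apply: (@Rolle_iter (fun n x => h n x - (P^`(n)).[x]) m s) => //.
  apply/allP => y /(nthP 0)[j]; rewrite sz => jm <-.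
  by rewrite derivn0 (PE (Ordinal jm)) subrr.
move/eqP; rewrite subr_eq0 => /eqP hP; exists xi; rewrite hP.
(* As [P] has degree at most [m], only its coefficient of index [m] survives [m] derivations. *)
have -> : P^`(m) = (P`_m *+ m`!)%:P.
  apply/polyP => i; rewrite coef_derivn coefC; case: eqP => [->|/eqP i0].
    by rewrite addn0 ffactnn.
  by rewrite nth_default ?mul0rn// (leq_trans szP)//; lia.
by rewrite hornerC Pm mulr_natl.
Qed.

(** In truncated subtraction [(i - j) + (j - i)] is the distance of [i] and [j]. The indices below
    [j] contribute [j!], those above contribute [(m - j)!]. *)
Lemma prod_dist m j : (j <= m)%N ->
  (\prod_(i < m.+1 | i != j :> nat) ((i - j) + (j - i)) = j`! * (m - j)`!)%N.
Proof.
move=> /subnKC => <-; rewrite addKn; elim: (m - j)%N => [|n IH]; last first.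
  rewrite addnS big_mkcond big_ord_recr/= -big_mkcond IH /=.
  by rewrite ifT; [rewrite factS; lia|lia].
rewrite addn0 muln1 big_mkcond big_ord_recr/= eqxx muln1.
elim: j => [|j IH]; first by rewrite big_ord0.
rewrite big_ord_recl /= factS; congr (_ * _)%N.
rewrite -IH; apply: eq_bigr => i _; rewrite /bump/= add1n.
have := ltn_ord i => ij; have -> : (i.+1 != j.+1)%N by lia.
lia.
Qed.

Lemma separated_nth (d : R) s i j : sorted (fun x y => x + d <= y) s ->
  (i + j < size s)%N -> s`_i + j%:R * d <= s`_(i + j).
Proof.
move=> ss; elim: j => [|j IH] ij; first by rewrite mul0r addr0 addn0.
rewrite -natr1 mulrDl mul1r addrA addnS.
apply: le_trans (sortedP 0 ss (i + j)%N _); last by rewrite -addnS.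
by rewrite lerD2r IH //; lia.
Qed.

End DividedDifferences.

(** * Counting zeros, covering sublevel sets and cutting intervals *)

Section Covering.
Variable R : realType.
Implicit Types (h : nat -> R -> R) (s : seq R).

(** Points of indices i and j are at least |i - j| d apart, so the divided difference is at most the
    sum over j of delta / (d^m j! (m - j)!). Multiplied by m! this sum is 2^m delta / d^m by the
    binomial theorem, whereas m! times the divided difference is a value of [h m], hence at least
    1. *)
Lemma separated_sublevel h m (delta d : R) s :
  (forall i (y : R), is_derive y 1 (h i) (h i.+1 y)) -> 0 < d ->
  sorted (fun x y => x + d <= y) s -> size s = m.+1 ->
  (forall y, y \in s -> `|h 0%N y| <= delta) -> (forall y, 1 <= h m y) ->
  d ^+ m <= 2 ^+ m * delta.
Proof.
move=> hD d0 ss sz hs h1.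
have dm0 : 0 < d ^+ m by rewrite exprn_gt0.
have slt : sorted <%R s.
  by apply: sub_sorted ss => x y; apply: lt_le_trans; rewrite ltrDl.
have [xi hxi] := divided_difference hD slt sz.
have dist (i j : 'I_m.+1) : ((i - j) + (j - i))%:R * d <= `|s`_j - s`_i|.
  have ij (a b : 'I_m.+1) : (a <= b)%N -> (b - a)%:R * d <= s`_b - s`_a.
    move=> ab; rewrite lerBrDl -{2}(subnKC ab); apply: separated_nth ss _.
    by rewrite subnKC // sz.
  case: (leqP i j) => [/[dup] /ij + ji|/ltnW/[dup] /ij + ji].
    by rewrite (eqP ji) add0n => /le_trans; apply; rewrite ler_norm.
  by rewrite (eqP ji) addn0 distrC => /le_trans; apply; rewrite ler_norm.
have term (j : 'I_m.+1) : `|h 0%N s`_j *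
    \prod_(i < m.+1 | i != j) (s`_j - s`_i)^-1| <=
    delta * (d ^+ m * (j`! * (m - j)`!)%:R)^-1.
  rewrite normrM ler_pM ?hs ?mem_nth ?sz// normr_prod.
  have -> : d ^+ m * (j`! * (m - j)`!)%:R =
      \prod_(i < m.+1 | i != j) (((i - j) + (j - i))%:R * d).
    rewrite big_split/= prodr_const -prod_dist -1?ltnS// natr_prod mulrC.
    by rewrite (cardC1 j) card_ord.
  rewrite -prodfV; apply: ler_prod => i ij; rewrite normr_ge0 /= normfV.
  rewrite lef_pV2 ?dist// posrE.
    apply: lt_le_trans (dist i j); rewrite mulr_gt0// ltr0n.
    by move: ij; rewrite -val_eqE /=; lia.
  by rewrite mulr_gt0// ltr0n; move: ij; rewrite -val_eqE /=; lia.
have : 1 <= m`!%:R * \sum_(j < m.+1) delta * (d ^+ m * (j`! * (m - j)`!)%:R)^-1.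
  apply: le_trans (h1 xi) _; rewrite hxi ler_wpM2l//.
  by apply: ler_sum => j _; apply: le_trans (ler_norm _) (term j).
suff -> : m`!%:R * \sum_(j < m.+1) delta * (d ^+ m * (j`! * (m - j)`!)%:R)^-1 =
    2 ^+ m * delta / d ^+ m by rewrite ler_pdivlMr// mul1r.
have -> : 2 ^+ m = \sum_(j < m.+1) 'C(m, j)%:R :> R.
  rewrite -natr_sum -natrX; congr (_%:R).
  by rewrite -[2%N]/(1 + 1)%N expnDn; apply: eq_bigr => j _; rewrite !exp1n !muln1.
rewrite mulr_sumr -mulrA mulr_suml; apply: eq_bigr => j _.
have jm : (j <= m)%N by rewrite -ltnS.
rewrite -(bin_fact jm) natrM invfM.
have f0 : (j`! * (m - j)`!)%:R != 0 :> R by rewrite pnatr_eq0 -lt0n muln_gt0 !fact_gt0.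
by move: _%:R f0 => q f0; field; rewrite f0 gt_eqF.
Qed.

(** A pairwise far family in [E] is enlarged point by point. If this stops at some family of at most
    [n] points, no point of [E] is far from all its members. *)
Lemma maximal_packing (T : eqType) (E : set T) (far : rel T) n :
  irreflexive far -> symmetric far ->
  (exists s : seq T, [/\ size s = n.+1, uniq s, (forall x, x \in s -> E x) &
     {in s &, forall x y, x != y -> far x y}]) \/
  (exists2 s : seq T, (size s <= n)%N &
     forall e, E e -> exists2 x, x \in s & ~~ far e x).
Proof.
move=> farr fars; elim: n => [|n [[s [sz us sE sfar]]|[s sz sE]]].
- have [[e Ee]|nE] := pselect (exists e, E e); last first.
    by right; exists [::] => // e Ee; case: nE; exists e.
  left; exists [:: e]; split=> // [x|x y]; rewrite !inE.
    by move/eqP ->.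
  by move=> /eqP -> /eqP ->; rewrite eqxx.
- have [[e [Ee es]]|nE] := pselect (exists e, E e /\ all (far e) s); last first.
    right; exists s; rewrite ?sz// => e Ee.
    apply/hasP; rewrite has_predC; apply/negP => es; apply: nE.
    by exists e.
  have es' : forall x, x \in s -> far e x by exact/allP.
  left; exists (e :: s); split => /=; first by rewrite sz.
  + by rewrite us andbT; apply/negP => /es'; rewrite farr.
  + by move=> x; rewrite inE => /predU1P[->//|]; exact: sE.
  + move=> x y; rewrite !inE => /predU1P[->|xs] /predU1P[->|ys].
    * by rewrite eqxx.
    * by rewrite es'.
    * by rewrite fars es'.
    * exact: sfar.
- by right; exists s => //; rewrite (leq_trans sz).
Qed.

(** A packing with distinctness as [far]: [n.+1] distinct zeros would force a zero of [h n] by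
    iterating Rolle's theorem. *)
Lemma zeros_seq h n : (forall i (y : R), is_derive y 1 (h i) (h i.+1 y)) ->
  (forall y, 1 <= h n y) ->
  exists2 s, (size s <= n)%N & forall y, h 0%N y = 0 -> y \in s.
Proof.
move=> hD h1.
have [||[s [sz us s0 _]]|[s sz s0]] :=
    @maximal_packing R [set y | h 0%N y = 0] (fun x y => x != y) n.
- by move=> x; rewrite eqxx.
- by move=> x y; rewrite eq_sym.
- have [|||x hx] := @Rolle_iter R h n (sort <=%R s) hD.
  + by rewrite sort_lt_sorted.
  + by rewrite size_sort.
  + by apply/allP => y; rewrite mem_sort => /s0 /eqP.
  + by move: (h1 x); rewrite hx ler10.
- by exists s => // y /s0[x xs /negPn/eqP ->].
Qed.

(** A packing with distance at least [d] as [far]: [m.+1] such points, once sorted, contradict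
    [separated_sublevel]. *)
Lemma sublevel_cover h m (delta d : R) :
  (forall i (y : R), is_derive y 1 (h i) (h i.+1 y)) ->
  (forall y, 1 <= h m y) -> 0 < d -> 2 ^+ m * delta < d ^+ m ->
  exists2 s, (size s <= m)%N &
    forall y, `|h 0%N y| <= delta -> exists2 x, x \in s & `|y - x| < d.
Proof.
move=> hD h1 d0 dm.
have [||[s [sz us sE sd]]|[s sz sE]] := @maximal_packing R
    [set y | `|h 0%N y| <= delta] (fun x y => d <= `|x - y|) m.
- by move=> x; rewrite subrr normr0 leNgt d0.
- by move=> x y; rewrite distrC.
- suff : d ^+ m <= 2 ^+ m * delta by rewrite leNgt dm.
  apply: (@separated_sublevel h m delta d (sort <=%R s)) => //.
  + apply/(sortedP 0) => i isz.
    have lts : sorted <%R (sort <=%R s) by rewrite sort_lt_sorted.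
    have lti := sortedP 0 lts i isz.
    rewrite addrC -lerBrDr; have <- := ger0_norm (ltW (etrans (subr_gt0 _ _) lti)).
    by apply: sd; rewrite ?gt_eqF// -(mem_sort <=%R) mem_nth// ltnW.
  + by rewrite size_sort.
  + by move=> y; rewrite mem_sort => /sE.
- by exists s => // y /sE[x xs]; rewrite -ltNge => ?; exists x.
Qed.

(** Strong induction on the number of cut points, splitting at any one inside the interval. [Z] may
    be unsorted, have repetitions or contain points outside [[a, b]]. *)
Lemma cut_bound (psi : R -> R) (K : R) (Z : seq R) (a b : R) :
  0 <= K -> a <= b ->
  (forall u v, a <= u -> u < v -> v <= b ->
    (forall z, z \in Z -> ~~ (u < z < v)) -> `|psi v - psi u| <= K) ->
  `|psi b - psi a| <= (size Z).+1%:R * K.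
Proof.
move=> K0; have [n] := ubnP (size Z); elim: n Z a b => // n IH Z a b sZ ab H.
have [->|ab'] := eqVneq a b; first by rewrite subrr normr0 mulr_ge0.
have {ab ab'}ab : a < b by rewrite lt_neqAle ab' ab.
have [/hasP[z zZ /andP[az zb]]|noz] :=
  boolP (has (fun z => a < z < b) Z); last first.
  apply: le_trans (H a b _ _ _ _) _ => //.
    by apply/allP; rewrite all_predC.
  by rewrite ler_peMl// ler1n.
(* The strict inequalities drop [z] from both halves, so their sizes add up to less than [size Z];
   this makes the counts of pieces add up. To the left of [z], avoiding [Z1] amounts to avoiding
   [Z], and likewise for [Z2] to the right. *)
pose Z1 := [seq y <- Z | y < z]; pose Z2 := [seq y <- Z | z < y].
have szZ : (size Z1 + size Z2 < size Z)%N.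
  rewrite !size_filter (perm_size (perm_to_rem zZ))/=.
  rewrite !(permP (perm_to_rem zZ))/= ltxx !add0n ltnS.
  elim: (rem z Z) => //= y s IHs; rewrite addnACA -add1n leq_add//.
  by case: ltgtP.
have szn : (size Z1 + size Z2 < n)%N := leq_trans szZ sZ.
have H1 : `|psi z - psi a| <= (size Z1).+1%:R * K.
  apply: IH; [exact: leq_ltn_trans (leq_addr _ _) szn|exact: ltW|].
  move=> u v au uv vz avoid.
  apply: H => // [|y yZ]; first by rewrite (le_trans vz)// ltW.
  apply/negP => /andP[uy yv]; have := avoid y; rewrite mem_filter yZ uy yv.
  by rewrite (lt_le_trans yv vz) => /(_ isT).
have H2 : `|psi b - psi z| <= (size Z2).+1%:R * K.
  apply: IH; [exact: leq_ltn_trans (leq_addl _ _) szn|exact: ltW|].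
  move=> u v zu uv vb avoid.
  apply: H => // [|y yZ]; first by rewrite (le_trans _ zu)// ltW.
  apply/negP => /andP[uy yv]; have := avoid y; rewrite mem_filter yZ uy yv.
  by rewrite (le_lt_trans zu uy) => /(_ isT).
rewrite (_ : psi b - psi a = (psi z - psi a) + (psi b - psi z)); last by ring.
apply: le_trans (ler_normD _ _) _; apply: le_trans (lerD H1 H2) _.
by rewrite -mulrDl ler_wpM2r// -natrD ler_nat addSn addnS ltnS.
Qed.

(** By the intermediate value theorem all values have the sign of [F u]; for [v < u] the claim is
    vacuous. *)
Lemma nonzero_sign (F : R -> R) (u v : R) : continuous F ->
  (forall x, u <= x <= v -> F x != 0) ->
  (forall x, u <= x <= v -> 0 < F x) \/ (forall x, u <= x <= v -> F x < 0).
Proof.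
move=> cF F0.
have sgn x y : u <= x -> x <= y -> y <= v -> 0 < F x * F y.
  move=> ux xy yv; rewrite ltNge; apply/negP => Fxy.
  have [|c] := @IVT R F x y 0 xy (continuous_subspaceT cF).
    by rewrite ge_min le_max; have [] := lerP 0 (F x); have [] := lerP 0 (F y); nra.
  rewrite in_itv/= => /andP[xc cy] Fc; have := F0 c; rewrite Fc eqxx.
  by rewrite (le_trans ux xc) (le_trans cy yv) => /(_ isT).
have [vu|uv] := ltP v u.
  by left => x /andP[ux xv]; move: (le_trans ux xv); rewrite leNgt vu.
have := F0 u; rewrite lexx uv => /(_ isT); rewrite neq_lt => /orP[Fu|Fu].
  by right => x /andP[ux xv]; have := sgn u x (lexx _) ux xv; rewrite nmulr_rgt0.
by left => x /andP[ux xv]; have := sgn u x (lexx _) ux xv; rewrite pmulr_rgt0.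
Qed.

End Covering.

(** * Oscillation over intervals where f' is large and monotone *)

Section SteepIntervals.
Variable R : realType.
Variables (phi p f g dg psi : R -> R).
Hypothesis phiD : forall y : R, is_derive y 1 phi (p y).
Hypothesis fD : forall y : R, is_derive y 1 f (g y).
Hypothesis gD : forall y : R, is_derive y 1 g (dg y).
Hypothesis psiD : forall y : R, is_derive y 1 psi (p (f y)).

(* The derivative of [psi - (phi(f) + c) / g] is [g' (phi(f) + c) / g^2]: for
   [c = eps] and [c = - eps] it has opposite signs where [g'] keeps its sign. *)
Lemma steep_MVT (c u v : R) : u < v -> (forall x, u <= x <= v -> g x != 0) ->
  exists2 x, u <= x <= v &
    psi v - psi u = (phi (f v) + c) / g v - (phi (f u) + c) / g u +
      dg x * ((phi (f x) + c) / g x ^+ 2 * (v - u)).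
Proof.
move=> uv g0.
pose H x := psi x - (phi (f x) + c) * (g x)^-1.
have HD (x : R) : u <= x <= v ->
    is_derive x 1 H (dg x * (phi (f x) + c) / g x ^+ 2).
  move=> /g0 gx.
  have pD := is_deriveD (is_derive1_comp (phiD (f x)) (fD x)) (is_derive_cst c x 1).
  have HD := is_deriveB (psiD x) (is_deriveM pD (is_deriveV gx (gD x))).
  apply: is_derive_eq HD _.
  rewrite /GRing.scale /= -[(_ + _ : R -> R) x]/(phi (f x) + c).
  by field.
have [|x] := @MVT R H (fun x => dg x * (phi (f x) + c) / g x ^+ 2) u v uv
    (fun x xuv => HD x (subset_itv_oo_cc xuv)).
  by apply: derivable_within_continuous => x; rewrite in_itv/= => /HD[].
rewrite in_itv/= => /andP[ux xv] e; exists x; first by rewrite !ltW.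
by rewrite !mulrA -e /H; ring.
Qed.

(** Each of the two end terms in [steep_MVT] is at most 2 eps / delta in absolute value. The
    remaining term has opposite signs for [c = eps] and [c = - eps], so one choice gives the upper
    bound and the other the lower bound. *)
Lemma steep_bound (eps delta u v : R) : continuous dg -> 0 < delta -> u < v ->
  (forall y, `|phi y| <= eps) ->
  (forall x, u <= x <= v -> delta <= `|g x|) ->
  (forall x, u <= x <= v -> dg x != 0) ->
  `|psi v - psi u| <= 4 * (eps / delta).
Proof.
move=> cdg d0 uv phie gd dg0.
have eps0 : 0 <= eps by apply: le_trans (phie 0).
have g0 x : u <= x <= v -> g x != 0.
  by move=> /gd; apply: contraTneq => ->; rewrite normr0 -ltNge.
have bnd c w : u <= w <= v -> `|c| <= eps ->
    `|(phi (f w) + c) / g w| <= 2 * (eps / delta).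
  move=> /gd gw ce; rewrite mulrA normrM normfV ler_pM ?invr_ge0//.
    by rewrite (le_trans (ler_normD _ _))// mulr_natl mulr2n lerD.
  by rewrite lef_pV2// posrE (lt_le_trans d0).
have uu : u <= u <= v by rewrite lexx ltW.
have vv : u <= v <= v by rewrite lexx ltW.
have ee : `|eps| <= eps by rewrite ger0_norm.
have Ne : `|- eps| <= eps by rewrite normrN.
have [x xuv Ex] := steep_MVT eps uv g0.
have [y yuv Ey] := steep_MVT (- eps) uv g0.
have vu : 0 <= v - u by rewrite subr_ge0 ltW.
have xp : 0 <= (phi (f x) + eps) / g x ^+ 2 * (v - u).
  by rewrite mulr_ge0// divr_ge0 ?sqr_ge0//; move: (phie (f x)); rewrite ler_norml; lra.
have yp : (phi (f y) - eps) / g y ^+ 2 * (v - u) <= 0.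
  rewrite mulr_le0_ge0// mulr_le0_ge0 ?invr_ge0 ?sqr_ge0//.
  by move: (phie (f y)); rewrite ler_norml; lra.
have [] := (bnd _ _ uu ee, bnd _ _ vv ee).
have [] := (bnd _ _ uu Ne, bnd _ _ vv Ne).
rewrite !ler_norml => /andP[? ?] /andP[? ?] /andP[? ?] /andP[? ?].
case: (nonzero_sign cdg dg0) => sdg.
- have dgx := mulr_ge0 (ltW (sdg x xuv)) xp.
  have dgy := mulr_ge0_le0 (ltW (sdg y yuv)) yp.
  by apply/andP; split; [rewrite Ex|rewrite Ey]; lra.
- have dgx := mulr_le0_ge0 (ltW (sdg x xuv)) xp.
  have dgy := mulr_le0 (ltW (sdg y yuv)) yp.
  by apply/andP; split; [rewrite Ey|rewrite Ex]; lra.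
Qed.

End SteepIntervals.

(** * Van der Corput's bound with a constant linear in the order of the derivative *)

Lemma van_der_corput (R : realType) (m : nat) (h : nat -> R -> R)
    (phi p psi : R -> R) (r a b : R) : (0 < m)%N -> 0 < r ->
  (forall i (y : R), is_derive y 1 (h i) (h i.+1 y)) ->
  (forall y, 1 <= h m.+1 y) ->
  (forall y : R, is_derive y 1 phi (p y)) ->
  (forall y : R, is_derive y 1 psi (p (h 0%N y))) ->
  (forall y, `|phi y| <= r ^+ m.+1) -> (forall y, `|p y| <= 1) -> a <= b ->
  `|psi b - psi a| <= 16 * m.+1%:R * r.
Proof.
move=> m0 r0 hD h1 phiD psiD phie p1 ab.
have rm0 : 0 < r ^+ m by rewrite exprn_gt0.
(* The covering needs 2^m r^m < d^m, which [d = 3 * r] satisfies because [m] is positive. *)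
have [s sz sE] : exists2 s, (size s <= m)%N & forall y, `|h 1%N y| <= r ^+ m ->
    exists2 x, x \in s & `|y - x| < 3 * r.
  apply: (@sublevel_cover _ (fun i => h i.+1) m) => //; first by lra.
  by rewrite exprMn ltr_pM2r// ltrXn2r -?lt0n//; lra.
have [Z0 szZ0 Z0E] : exists2 Z, (size Z <= m.-1)%N &
    forall y, h 2%N y = 0 -> y \in Z.
  apply: (@zeros_seq _ (fun i => h i.+2) m.-1) => // y.
  by rewrite prednK.
have lip u v : u <= v -> `|psi v - psi u| <= v - u.
  rewrite le_eqVlt => /predU1P[->|uv]; first by rewrite !subrr normr0.
  have [c [_ _ ->]] := MVT_itv uv psiD.
  by rewrite normrM (gtr0_norm (_ : 0 < v - u)) ?subr_gt0// ler_piMl// subr_ge0 ltW.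
(* The cuts are the centres and both ends of the covering intervals, and the zeros of [h 2]: at most
   3m + (m - 1) points, hence at most 4m pieces, each contributing at most 4 r. *)
pose Z := s ++ map (fun x => x - 3 * r) s ++ map (fun x => x + 3 * r) s ++ Z0.
have szZ : (size Z).+1%:R * (4 * r) <= 16 * m.+1%:R * r.
  have -> : 16 * m.+1%:R * r = (4 * m.+1)%:R * (4 * r) by rewrite natrM; ring.
  rewrite ler_wpM2r//; first by lra.
  rewrite ler_nat !size_cat !size_map.
  by apply: leq_ltn_trans (leq_add sz (leq_add sz (leq_add sz szZ0))) _; lia.
apply: le_trans (@cut_bound R psi (4 * r) Z a b _ ab _) szZ; first by lra.
move=> u v _ uv _ avoid.
(* If the piece meets the sublevel set at [e], then [e] is within 3 r of a centre [x]. As [x] and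
   [x] ± 3 r are cuts, the piece lies in one half of that covering interval and has length at most 3
   r. *)
have [[e [ue ev he]]|nE] :=
    pselect (exists e, [/\ u < e, e < v & `|h 1%N e| <= r ^+ m]).
  have [x xs xe] := sE e he.
  have avZ z : z \in Z -> z <= u \/ v <= z.
    move=> /avoid; rewrite negb_and -!leNgt => /orP[]; [by left|by right].
  have xZ : x \in Z by rewrite mem_cat xs.
  have xmZ : x - 3 * r \in Z by rewrite !mem_cat (map_f (fun x => x - 3 * r)) ?orbT.
  have xpZ : x + 3 * r \in Z by rewrite !mem_cat (map_f (fun x => x + 3 * r)) ?orbT.
  apply: le_trans (lip _ _ (ltW uv)) _.
  move: xe; rewrite ltr_norml => /andP[xe1 xe2].
  by case: (avZ _ xZ); case: (avZ _ xmZ); case: (avZ _ xpZ); lra.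
(* The ends [u] and [v] may themselves be zeros of [h 2], so the steep bound is applied on closed
   intervals strictly inside. *)
have steep u' v' : u < u' -> u' < v' -> v' < v -> `|psi v' - psi u'| <= 4 * r.
  move=> uu' uv' vv'.
  have -> : 4 * r = 4 * (r ^+ m.+1 / r ^+ m).
    by rewrite exprS mulfK// gt_eqF.
  apply: (@steep_bound R phi p (h 0%N) (h 1%N) (h 2%N) psi) => //.
  - by move=> x; apply: is_derive_continuous (hD 2%N).
  - move=> x /andP[ux xv]; rewrite leNgt; apply/negP => /ltW hx; apply: nE.
    by exists x; rewrite (lt_le_trans uu' ux) (le_lt_trans xv vv').
  - move=> x /andP[ux xv]; apply/eqP => /Z0E xZ0; have := avoid x.
    rewrite !mem_cat xZ0 !orbT (lt_le_trans uu' ux) (le_lt_trans xv vv').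
    by move=> /(_ isT).
(* Shrinking the piece by [t] at both ends costs at most 2 t, hence at most [e], because [psi] is
   1-Lipschitz. *)
apply/ler_addgt0Pl => e e0.
pose t := Num.min (e / 2) ((v - u) / 3).
have t0 : 0 < t by rewrite lt_min; apply/andP; split; lra.
have te : t <= e / 2 by rewrite ge_min lexx.
have tu : t <= (v - u) / 3 by rewrite ge_min lexx orbT.
have -> : psi v - psi u = (psi v - psi (v - t)) +
  ((psi (v - t) - psi (u + t)) + (psi (u + t) - psi u)) by ring.
apply: le_trans (ler_normD _ _) _.
have H1 : `|psi v - psi (v - t)| <= v - (v - t) by apply: lip; lra.
have H2 : `|psi (u + t) - psi u| <= (u + t) - u by apply: lip; lra.
have H3 : `|psi (v - t) - psi (u + t)| <= 4 * r by apply: steep; lra.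
apply: le_trans (lerD H1 (le_trans (ler_normD _ _) (lerD H3 H2))) _.
lra.
Qed.

(** * Antiderivatives, translation invariance and integration against a density *)

Section Integration.
Variable R : realType.
Local Notation mu := (@lebesgue_measure R).
Local Notation translate h :=
  ((fun x => x + h) : measurableTypeR R -> measurableTypeR R).

(* The lower limit [- `|y| - 2] is constant near [y], which makes the integral
   below an antiderivative on the whole line. *)
Lemma continuous_antiderivative (F : R -> R) : continuous F ->
  exists psi : R -> R, forall y : R, is_derive y 1 psi (F y).
Proof.
move=> cF.
pose G a x := (\int[mu]_(t in `[a, x]) F t)%R.
have intF a b : mu.-integrable `[a, b] (EFin \o F).
  apply: continuous_compact_integrable; first exact: segment_compact.
  exact: continuous_subspaceT.
have GB a b x : a <= b -> b <= x -> G a x = G a b + G b x.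
  move=> ab bx; have := @Rintegral_itvB R F (BLeft a) (BRight x) b (intF a x).
  rewrite !bnd_simp => /(_ ab bx).
  rewrite Rintegral_itv_obnd_cbnd => [e|]; first by rewrite /G -e; ring.
  apply: integrableS (intF b x) => //; exact: subset_itv_oc_cc.
(* The difference does not depend on the lower limit as long as that limit is below both [x] and
   0. *)
have GI a b x : a <= x -> a <= 0 -> b <= x -> b <= 0 ->
    G a x - G a 0 = G b x - G b 0.
  wlog ab : a b / a <= b => [wlg ax a0 bx b0|_ _ bx b0].
    by case: (leP a b) => [|/ltW] ab; [exact: wlg|symmetry; exact: wlg].
  by rewrite (GB a b x ab bx) (GB a b 0 ab b0); ring.
exists (fun x => G (- `|x| - 1) x - G (- `|x| - 1) 0) => y.
pose a : R := - `|y| - 2.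
have y1 : y < y + 1 by rewrite ltrDl.
have ay : a < y by rewrite /a; move: (ler_norm (- y)); rewrite normrN; lra.
have [dG GE] := @continuous_FTC1 R F (BLeft a) y (y + 1) y1 (intF _ _) ay (cF y).
apply: (@near_eq_is_derive _ _ _ (fun x => G a x - G a 0)).
  near=> x.
  have yx : `|y - x| < 1 by near: x; exact: cvgr_dist_lt.
  have := ler_norm (- x); rewrite normrN => Nx.
  have x0 := normr_ge0 x; have y0 := normr_ge0 y.
  have Ny : `|x| <= `|y| + 1.
    rewrite -(subrK y x) addrC (le_trans (ler_normD _ _))// lerD2l distrC ltW//.
  by apply: GI; rewrite /a; lra.
apply: is_derive_eq; last exact: subr0.
apply: is_deriveB; rewrite -GE derive1E; exact: derivableP.
Unshelve. all: end_near. Qed.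


Lemma measurable_shift (h : R) :
  measurable_fun [set: measurableTypeR R] (translate h).
Proof.
by apply: continuous_measurable_fun => x; apply: cvgD; [exact: cvg_id|exact: cvg_cst].
Qed.

(** The translated measure gives half-open intervals their length, and this determines Lebesgue
    measure. *)
Lemma lebesgue_measure_shift (h : R) (A : set (measurableTypeR R)) : measurable A ->
  mu A = pushforward mu (translate h) A.
Proof.
apply: (@lebesgue_measure_unique R (pushforward mu _));
  first exact: measurable_shift.
move=> mh X /ocitvP[->|[[a b] /= ab ->]]; first by rewrite !measure0.
have -> : pushforward mu (translate h) `]a, b] = mu `]a - h, b - h]%classic.
  congr (mu _); apply/seteqP; split => x /=; rewrite !in_itv/= ltrBlDr lerBrDr//.
rewrite !lebesgue_measure_itv/= !lte_fin ltrD2r ab -!EFinB; congr (_%:E); ring.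
Qed.

Lemma integral_pushforward_shift (h : R) (F : R -> \bar R) :
  (\int[mu]_x F x =
   \int[pushforward mu (translate h)]_x F x)%E.
Proof.
apply: (@eq_measure_integral _ _ _ _ (pushforward mu _) mu F);
  first exact: measurable_shift.
by move=> mh A mA _; exact: lebesgue_measure_shift.
Qed.

Lemma integrable_shift (h : R) (F : R -> R) :
  mu.-integrable [set: R] (EFin \o F) ->
  mu.-integrable [set: R] (EFin \o (fun x => F (x + h))).
Proof.
move=> /integrableP[mF iF]; apply/integrableP; split.
  exact: (measurableT_comp mF (measurable_shift h)).
apply: le_lt_trans iF; rewrite le_eqVlt; apply/orP; left; apply/eqP.
rewrite [RHS](integral_pushforward_shift h) ge0_integral_pushforward//;
  first exact: measurable_shift.
exact: measurableT_comp.
Qed.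

Lemma integral_shift (h : R) (F : R -> R) :
  mu.-integrable [set: R] (EFin \o F) ->
  (\int[mu]_x (F (x + h))%:E = \int[mu]_x (F x)%:E)%E.
Proof.
move=> iF.
rewrite [RHS](integral_pushforward_shift h) integral_pushforward//;
  first exact: measurable_shift.
  exact: measurable_int iF.
exact: integrable_shift.
Qed.

Lemma BVnorm_ge (rho : R -> R) (h : R) : 0 < h ->
  ((h^-1)%:E * \int[mu]_x `|rho (x - h) - rho x|%:E <= BVnorm rho)%E.
Proof.
move=> h0; apply: (@le_trans _ _ ((h^-1)%:E * omega rho h)%E).
  rewrite lee_pmul2l ?lte_fin ?invr_gt0//; apply: ereal_sup_ubound.
  by exists (- h) => //=; rewrite normrN gtr0_norm.
by apply: ereal_sup_ubound; exists h.
Qed.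

Lemma integrable_bounded_continuous
    (m : {measure set (measurableTypeR R) -> \bar R})
    (psi rho : R -> R) (M : R) :
  m.-integrable [set: R] (EFin \o rho) -> continuous psi ->
  (forall x, `|psi x| <= M) ->
  m.-integrable [set: R] (EFin \o (fun x => psi x * rho x)).
Proof.
move=> irho cpsi psiM.
have mpsi : measurable_fun [set: measurableTypeR R] psi.
  exact: continuous_measurable_fun.
rewrite (_ : _ \o _ = ((EFin \o rho) \* (EFin \o psi))%E); last first.
  by apply/funext => x /=; rewrite mulrC.
apply: integrableMl => //; exists M; split; first exact: num_real.
by move=> K MK x _; exact: le_trans (psiM x) (ltW MK).
Qed.

(* Translation invariance moves the difference quotient of [psi] onto [rho]. *)
Lemma difference_quotient_bound (rho psi : R -> R) (M h : R) : 0 < h ->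
  mu.-integrable [set: R] (EFin \o rho) -> continuous psi ->
  (forall x, `|psi x| <= M) ->
  (\int[mu]_x (h^-1 * (psi (x + h) - psi x) * rho x)%:E <= M%:E * BVnorm rho)%E.
Proof.
move=> h0 irho cpsi psiM.
have M0 : 0 <= M by apply: le_trans (psiM 0).
have cpsih : continuous (fun x => psi (x + h)).
  move=> x; apply: (@continuous_comp _ _ _ (fun x => x + h) psi); last exact: cpsi.
  by apply: cvgD; [exact: cvg_id|exact: cvg_cst].
have irhoh : mu.-integrable [set: R] (EFin \o (fun x => rho (x - h))).
  exact: integrable_shift.
have i1 := integrable_bounded_continuous irho cpsi psiM.
have i2 := integrable_bounded_continuous irhoh cpsi psiM.
have i3 := integrable_bounded_continuous irho cpsih (fun x => psiM (x + h)).
have -> : (\int[mu]_x (h^-1 * (psi (x + h) - psi x) * rho x)%:E =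
    (h^-1)%:E * \int[mu]_x (psi x * rho (x - h) - psi x * rho x)%:E)%E.
  rewrite [in RHS]integralB_EFin// -(integral_shift h i2).
  have -> : (\int[mu]_x (psi (x + h) * rho (x + h - h))%:E =
      \int[mu]_x (psi (x + h) * rho x)%:E)%E.
    by apply: eq_integral => x _; rewrite addrK.
  rewrite -integralB_EFin// -integralZl//; last exact: integrableB.
  by apply: eq_integral => x _; rewrite -EFinB -EFinM; congr _%:E; ring.
rewrite (le_trans _ (lee_wpmul2l _ (BVnorm_ge rho h0)))//.
rewrite muleCA lee_wpmul2l// ?lee_fin ?invr_ge0 ?(ltW h0)//.
have idiff : mu.-integrable [set: R] (EFin \o (fun x => rho (x - h) - rho x)).
  exact (integrableB measurableT irhoh irho).
rewrite -integralZl//; last exact: integrable_abse idiff.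
apply: le_integral => //.
- exact (integrableB measurableT i2 i1).
- apply: integrableZl => //; exact: integrable_abse idiff.
- move=> x _; rewrite -EFinM lee_fin -mulrBr (le_trans (ler_norm _))// normrM.
  by rewrite ler_wpM2r.
Qed.

(** Difference quotients of step 1/(n + 1) converge to [dpsi] and are at most 1 in absolute value,
    since [psi] is 1-Lipschitz. Dominated convergence with majorant |rho| carries the bound on them
    to the limit. *)
Lemma bounded_variation_bound (rho psi dpsi : R -> R) (M : R) :
  mu.-integrable [set: R] (EFin \o rho) ->
  (forall y : R, is_derive y 1 psi (dpsi y)) -> continuous dpsi ->
  (forall x, `|psi x| <= M) -> (forall x, `|dpsi x| <= 1) ->
  (\int[mu]_x (dpsi x * rho x)%:E <= M%:E * BVnorm rho)%E.
Proof.
move=> irho psiD cdpsi psiM dpsi1.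
have cpsi : continuous psi by move=> x; exact: is_derive_continuous psiD.
pose h (n : nat) : R := n.+1%:R^-1.
have h0 n : 0 < h n by rewrite invr_gt0.
pose F n x : \bar R := ((h n)^-1 * (psi (x + h n) - psi x) * rho x)%:E.
have lip x n : `|(h n)^-1 * (psi (x + h n) - psi x)| <= 1.
  have xh : x < x + h n by rewrite ltrDl.
  have [c [_ _ ->]] := MVT_itv xh psiD.
  by rewrite addrC addKr mulrC mulfK ?gt_eqF.
have mF n : measurable_fun [set: measurableTypeR R] (F n).
  apply: measurable_int (integrable_bounded_continuous irho _ (lip ^~ n)) => x.
  apply: cvgM; first exact: cvg_cst.
  apply: cvgB; last exact: cpsi.
  apply: (@continuous_comp _ _ _ (fun x => x + h n) psi); last exact: cpsi.
  by apply: cvgD; [exact: cvg_id|exact: cvg_cst].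
have iR : mu.-integrable [set: R] (fun x => `|rho x|%:E).
  exact: integrable_abse irho.
have [|||_ _ cF] := @dominated_convergence _ _ _ mu [set: R] measurableT F
  (fun x => (dpsi x * rho x)%:E) (fun x => `|rho x|%:E) mF _ _ iR.
- exact: measurable_int (integrable_bounded_continuous irho cdpsi dpsi1).
- apply: aeW => x _; apply: cvg_EFin; first by near=> n.
  apply: cvgMl.
  have [/cvgr_dnbhsP dpsix <-] := psiD x.
  apply: cvg_trans (dpsix h _); last first.
    by split; [move=> n; rewrite gt_eqF|exact: cvg_harmonic].
  by apply: near_eq_cvg; near=> n; rewrite /= /GRing.scale/= mulr1 (addrC x).
- apply: aeW => x n _; rewrite /F /= lee_fin normrM ler_piMl//.
apply: (cvge_to_le cF); near=> n; exact: difference_quotient_bound.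
Unshelve. all: end_near. Qed.

Lemma integrable_finite_bounded (nu : probability (measurableTypeR R) R)
    (G : R -> R) (M : R) :
  continuous G -> (forall x, `|G x| <= M) ->
  nu.-integrable [set: R] (EFin \o G).
Proof.
move=> cG GM; have i1 : nu.-integrable [set: R] (EFin \o (cst 1 : R -> R)).
  exact: finite_measure_integrable_cst.
have := integrable_bounded_continuous i1 cG GM.
by under [in X in X -> _]eq_fun do rewrite /= mulr1.
Qed.

(** As [rho] may be negative on a null set, the formula is taken from the Radon-Nikodym derivative
    of [nu]. That derivative equals [rho] almost everywhere, both having the same integral over
    every measurable set. *)
Lemma density_integral (nu : probability (measurableTypeR R) R)
    (rho G : R -> R) (M : R) :
  has_density nu rho -> continuous G -> (forall x, `|G x| <= M) ->
  (\int[nu]_x (G x)%:E = \int[mu]_x (G x * rho x)%:E)%E.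
Proof.
move=> [irho nuE] cG GM.
have mrho := measurable_int _ irho.
have numu : nu `<< mu.
  move=> A A0 B mB BA; rewrite nuE// null_set_integral//.
    exact: measurable_funTS.
  exact: A0.
have iG := integrable_finite_bounded nu cG GM.
rewrite -(Radon_Nikodym_change_of_variables numu measurableT iG).
apply: ae_eq_integral => //.
- apply: emeasurable_funM; first exact: measurable_int iG.
  by apply: measurable_int; exact: Radon_Nikodym_integrable.
- exact: measurable_int (integrable_bounded_continuous irho cG GM).
- under [X in ae_eq _ _ _ X]eq_fun do rewrite EFinM.
  apply: ae_eqe_mul2l; apply: integral_ae_eq => //.
    exact: Radon_Nikodym_integrable.
  by move=> E _ mE; rewrite -Radon_Nikodym_integral// -nuE.
Qed.

End Integration.

(** * The estimate for the image measure under a smooth function *)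

Lemma smooth_is_derive (R : realType) (f : R -> R) (n : nat) (x : R) : smooth f ->
  is_derive x 1 (derive1n n f) (derive1n n.+1 f x).
Proof. by move=> sf; rewrite derive1nS derive1E; apply/derivableP/sf. Qed.

Lemma sup_norm_le (R : realType) (phi : R -> R) (M x : R) :
  (sup_norm phi <= M%:E)%E -> `|phi x| <= M.
Proof.
by rewrite -lee_fin; apply: le_trans; apply: ereal_sup_ubound; exists x.
Qed.

Theorem theorem1p3 (R : realType) :
  exists C : R, 0 < C /\
    forall (k : nat), (2 <= k)%N ->
    forall (nu : probability (measurableTypeR R) R) (rho : R -> R),
      has_density nu rho -> (BVnorm rho < +oo)%E ->
    forall f : R -> R,
      smooth f -> (forall t : R, 1 <= derive1n k f t) ->
    forall eps : R, 0 < eps ->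
      (sigma (pushforward nu f) eps <=
         (C * k%:R)%:E * BVnorm rho * (eps `^ (k%:R^-1))%:E)%E.
Proof.
(* The constant is that of [van_der_corput]; [k] becomes [m.+2], and the lemma is applied with
   [m.+1]. *)
exists 16; split => // -[|[|m]]// _ nu rho dens _ f sf fk eps eps0.
set r := eps `^ _.
have r0 : 0 < r by exact: powR_gt0.
have rE : r ^+ m.+2 = eps.
  by rewrite -powR_mulrn ?ltW// -powRrM mulVf ?powRr1// ltW.
apply: ge_ereal_sup => _ [phi [[sphi _] phie dphi1] <-].
have fD i y := smooth_is_derive i y sf.
have phiD i y := smooth_is_derive i y sphi.
have cf : continuous f by move=> x; exact: is_derive_continuous (fD 0%N).
have cdphi : continuous (derive1 phi).
  by move=> x; exact: is_derive_continuous (phiD 1%N).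
have dphi1' x := sup_norm_le x dphi1.
have cG : continuous (derive1 phi \o f).
  by move=> x; apply: continuous_comp; [exact: cf|exact: cdphi].
have [psi psiD] := continuous_antiderivative cG.
(* Subtracting [psi 0] turns the bound on increments into a bound on the supremum, without changing
   the derivative. *)
have psiB x : `|psi x - psi 0| <= 16 * m.+2%:R * r.
  have phie' y : `|phi y| <= r ^+ m.+2 by rewrite rE; exact: sup_norm_le.
  have vdc a b := @van_der_corput R m.+1 (fun i => derive1n i f) phi
    (derive1 phi) psi r a b isT r0 fD fk (phiD 0%N) psiD phie' dphi1'.
  by case: (leP 0 x) => [|/ltW] /vdc//; rewrite distrC.
have mf : measurable_fun [set: measurableTypeR R]
    (f : measurableTypeR R -> measurableTypeR R).
  exact: continuous_measurable_fun.
have mdphi : measurable_fun [set: measurableTypeR R] (EFin \o derive1 phi).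
  by apply/measurable_EFinP; exact: continuous_measurable_fun.
have dphi1f x := dphi1' (f x).
(* The integral is moved from the image measure to [nu], and then through the density to Lebesgue
   measure. *)
rewrite (integral_pushforward mf mdphi (integrable_finite_bounded nu cG dphi1f))//.
rewrite (density_integral dens cG dphi1f) muleAC -EFinM.
apply: (bounded_variation_bound (psi := fun x => psi x - psi 0)) => //.
  by case: dens.
by move=> y; apply: is_derive_eq; rewrite subr0.
Qed.
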